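(* There are (up to isomorphism) $2^{n-1}$ linearly ordered preorder forest $P$-frames with $n$ elements ($n\ge 1$). In the algebraic setting, for $n>1$, there are (up to isomorphism) $2^{n-2}$ unary-determined commutative doubly idempotent linear semirings with $n$ elements, and $n-1$ of them have an identity element.
   Context: A $P$-frame is a structure $(W,\le,P)$ where $(W,\le)$ is a poset and $P\subseteq W^2$ satisfies: $u\le x$, $xPy$, $y\le v$ imply $uPv$. A preorder forest $P$-frame is a $P$-frame in which $P$ is reflexive and transitive and which satisfies, for all $x,y,z$: $xPy$ and $xPz$ imply ($x\le y$ or $x\le z$ or $yPz$ or $zPy$). It is linearly ordered if $(W,\le)$ is a chain. A semiring here has two binary operations $\vee,\cdot$, where $\vee$ is associative and commutative, $\cdot$ is associative, and $\cdot$ distributes over $\vee$ from the left and right. It is doubly idempotent if $x\vee x=x$ and $x\cdot x=x$ for all $x$, and commutative if $x\cdot y=y\cdot x$ for all $x,y$. It is linear if the order given by $x\le y\iff x\vee y=y$ is a chain; in that case $\wedge$ denotes the meet (minimum) of this chain, and in the finite case $\top$ denotes its greatest element. It is unary-determined if $x\cdot y=((x\cdot\top)\wedge y)\vee(x\wedge(\top\cdot y))$ for all $x,y$. An identity element is an element $1$ with $1\cdot x=x=x\cdot 1$ for all $x$.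
   Formalization: The semirings are also required to have a zero (a least element, neutral for ∨ and annihilating for ·); without it the counts fail: on the chain 0<1 both · = ∧ and · = ∨ qualify, giving 2 semirings for n=2 instead of 1. *)

(* Defs.v *)
From mathcomp Require Import all_boot.

Set Implicit Arguments.
Unset Strict Implicit.
Unset Printing Implicit Defensive.

(* Up to [iso], there are exactly [N] structures in the class [C]. *)
Definition count_up_to_iso (S : Type) (iso : S -> S -> Prop) (C : S -> Prop)
    (N : nat) : Prop :=
  exists F : 'I_N -> S,
    [/\ forall i, C (F i),
        forall i j, iso (F i) (F j) -> i = j
      & forall A, C A -> exists i, iso A (F i)].

Record pframe := PFrame {
  pf_sort :> finType;
  pf_le : rel pf_sort;
  pf_P : rel pf_sort;
  pf_le_refl : reflexive pf_le;
  pf_le_anti : antisymmetric pf_le;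
  pf_le_trans : transitive pf_le;
  pf_compat : forall u x y v,
    pf_le u x -> pf_P x y -> pf_le y v -> pf_P u v
}.

Definition preorder_forest (W : pframe) : Prop :=
  [/\ reflexive (@pf_P W), transitive (@pf_P W)
    & forall x y z : W, pf_P x y -> pf_P x z ->
        [\/ pf_le x y, pf_le x z, pf_P y z | pf_P z y]].

Definition linearly_ordered (W : pframe) : Prop := total (@pf_le W).

Definition pframe_iso (V W : pframe) : Prop :=
  exists f : V -> W,
    [/\ bijective f,
        {mono f : x y / pf_le x y >-> pf_le x y}
      & {mono f : x y / pf_P x y >-> pf_P x y}].

Record semiring := Semiring {
  sr_sort :> finType;
  sr_join : sr_sort -> sr_sort -> sr_sort;
  sr_mul : sr_sort -> sr_sort -> sr_sort;
  sr_joinA : associative sr_join;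
  sr_joinC : commutative sr_join;
  sr_mulA : associative sr_mul;
  sr_mulDr : right_distributive sr_mul sr_join;
  sr_mulDl : left_distributive sr_mul sr_join
}.

Definition sr_le (S : semiring) : rel S := fun x y => sr_join x y == y.

(* This is the meet only when [sr_le] is a chain. *)
Definition sr_meet (S : semiring) (x y : S) : S := if sr_le x y then x else y.

Definition sr_commutative (S : semiring) : Prop := commutative (@sr_mul S).

Definition doubly_idempotent (S : semiring) : Prop :=
  idempotent_op (@sr_join S) /\ idempotent_op (@sr_mul S).

Definition linear (S : semiring) : Prop :=
  [/\ reflexive (@sr_le S), antisymmetric (@sr_le S),
      transitive (@sr_le S) & total (@sr_le S)].

Definition is_top (S : semiring) (t : S) : Prop := forall x : S, sr_le x t.

Definition unary_determined (S : semiring) : Prop :=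
  exists2 t : S, is_top t
    & forall x y : S,
        sr_mul x y = sr_join (sr_meet (sr_mul x t) y) (sr_meet x (sr_mul t y)).

Definition has_identity (S : semiring) : Prop :=
  exists e : S, left_id e (@sr_mul S) /\ right_id e (@sr_mul S).

(* Distributivity over the empty join: the least element exists and annihilates.
   It matches the complex algebra of a P-frame, in which the empty set
   annihilates.  It does not follow from the binary distributive laws: with
   mul := join, a finite chain satisfies every other condition above, and
   without [has_zero] there would be 2 ^ (n - 1) semirings on n elements,
   n of them with an identity. *)
Definition has_zero (S : semiring) : Prop :=
  exists z : S,
    [/\ left_id z (@sr_join S), left_zero z (@sr_mul S)
      & right_zero z (@sr_mul S)].

Definition udcdi_linear_semiring (S : semiring) : Prop :=
  [/\ unary_determined S, sr_commutative S, doubly_idempotent S & linear S].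

Definition semiring_iso (S T : semiring) : Prop :=
  exists f : S -> T,
    [/\ bijective f,
        {morph f : x y / sr_join x y >-> sr_join x y}
      & {morph f : x y / sr_mul x y >-> sr_mul x y}].

(* Main.v *)
Require Import Defs.
From mathcomp Require Import all_boot.
From mathcomp Require Import zify.

Set Implicit Arguments.
Unset Strict Implicit.
Unset Printing Implicit Defensive.

(** Transport everything along the unique order isomorphism onto
    [0 < 1 < ... < n-1].
    A preorder forest [P] on this chain contains [<=], so it is a total preorder
    determined by the [k < n-1] with [~ P (k+1) k], and every set of such [k]
    occurs.
    On the semiring side, [f x = x * top] is a closure operator and
    unary-determinedness says [x * y = (x \/ y) /\ f x /\ f y].  Conversely every
    closure operator yields a semiring in this way.  It is determined by its fixed
    points, which always include the top and, because of the zero, the bottom;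
    the others are arbitrary.  There is an identity [e] exactly when the fixed
    points are the top and the elements below [e], where [e] is not the bottom. *)

(** * Counting by codes, and rigidity of finite chains *)

Lemma count_up_to_iso_card (J : finType) (S : Type) (iso : S -> S -> Prop)
    (C : S -> Prop) (F : J -> S) :
  (forall j, C (F j)) -> (forall i j, iso (F i) (F j) -> i = j) ->
  (forall A, C A -> exists j, iso A (F j)) -> count_up_to_iso iso C #|J|.
Proof.
move=> CF F_inj F_surj; exists (F \o enum_val); split=> [i|i j /F_inj|A].
- exact: CF.
- exact: enum_val_inj.
- by move=> /F_surj[j isoAj]; exists (enum_rank j); rewrite /= enum_rankK.
Qed.

Lemma card_set_ord m : #|{set 'I_m}| = 2 ^ m.
Proof. by rewrite -cardsT -powersetT card_powerset cardsT card_ord. Qed.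

(** The isomorphism sends [x] to its rank, the number of elements strictly below it. Antisymmetry
    makes the rank injective, hence bijective by cardinality. *)
Lemma chain_iso_ord (T : finType) (le : rel T) n :
  #|T| = n -> reflexive le -> antisymmetric le -> transitive le -> total le ->
  exists2 f : T -> 'I_n, bijective f & {mono f : x y / le x y >-> x <= y}.
Proof.
move=> <- le_refl le_anti le_trans le_total.
pose r x := #|[set y | ~~ le x y]|.
have r_lt x : r x < #|T|.
  rewrite -cardsT; apply: proper_card; rewrite properT.
  by apply/eqP=> /setP/(_ x); rewrite !inE le_refl.
have mono_r : {mono r : x y / le x y >-> x <= y}.
  move=> x y; apply/idP/idP; last first.
    move=> lexy; apply: subset_leq_card; apply/subsetP=> z; rewrite !inE.
    by apply: contra; apply: le_trans.
  apply: contraLR => nlexy; rewrite -ltnNge; apply: proper_card.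
  have leyx : le y x by have := le_total x y; rewrite (negPf nlexy).
  apply/properP; split.
    apply/subsetP=> z; rewrite !inE.
    by apply: contra; apply: le_trans.
  by exists y; rewrite !inE ?le_refl.
exists (fun x => Ordinal (r_lt x)) => //.
apply: inj_card_bij; last by rewrite card_ord.
move=> x y [rxy]; apply: le_anti; apply/andP.
by rewrite -!mono_r rxy.
Qed.

(** An order embedding of the chain into itself never moves a point down; apply this to [f] and to
    its inverse. Isomorphic structures on the standard chain are therefore equal, so distinct codes
    give non-isomorphic structures. *)
Lemma ord_mono_id n (f : 'I_n -> 'I_n) :
  bijective f -> {mono f : x y / x <= y} -> f =1 id.
Proof.
have ge_id (h : 'I_n -> 'I_n) : {mono h : x y / x <= y} -> forall x : 'I_n, x <= h x.
  move=> h_mono [k]; elim: k => [//|k IHk] ltkn /=.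
  apply: (leq_ltn_trans (IHk (ltnW ltkn))).
  by rewrite ltnNge h_mono -ltnNge /=.
move=> [g fK gK] f_mono x; apply/val_inj/eqP; rewrite eqn_leq (ge_id f) // andbT.
have g_mono : {mono g : x y / x <= y} by move=> y z; rewrite -f_mono !gK.
by rewrite -{2}(fK x) (ge_id g).
Qed.

(** * Linearly ordered preorder forests *)

Section CutFrame.
Variables (m : nat) (B : {set 'I_m}).

(** A cut [k] lies between [k] and [k+1]; the relation fails only for a descent from [i] to [j] that
    crosses a cut. *)
Definition cut_rel : rel 'I_m.+1 :=
  fun i j => [forall k in B, (j <= k) ==> (i <= k)].

Lemma cut_relP (i j : 'I_m.+1) :
  reflect (forall k, k \in B -> j <= k -> i <= k) (cut_rel i j).
Proof.
apply: (iffP forall_inP) => H k kB; first exact/implyP/H.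
exact/implyP/H.
Qed.

Lemma cut_rel_compat (u x y v : 'I_m.+1) :
  u <= x -> cut_rel x y -> y <= v -> cut_rel u v.
Proof.
move=> leux /cut_relP Pxy leyv; apply/cut_relP=> k kB levk.
exact: leq_trans leux (Pxy k kB (leq_trans leyv levk)).
Qed.

Definition ord_le n : rel 'I_n := fun i j => i <= j.

Lemma ord_le_refl n : reflexive (@ord_le n). Proof. by move=> i; apply: leqnn. Qed.

Lemma ord_le_anti n : antisymmetric (@ord_le n).
Proof. by move=> i j; rewrite /ord_le -eqn_leq => /eqP/val_inj. Qed.

Lemma ord_le_trans n : transitive (@ord_le n).
Proof. by move=> j i k; apply: leq_trans. Qed.

Definition cut_frame : pframe :=
  PFrame (@ord_le_refl _) (@ord_le_anti _) (@ord_le_trans _) cut_rel_compat.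

Lemma cut_frame_forest : preorder_forest cut_frame.
Proof.
split=> [i|j i k /cut_relP Pij /cut_relP Pjk|i j k _ _].
- exact/cut_relP.
- by apply/cut_relP=> l lB /Pjk-/(_ lB)/Pij; apply.
- have [lejk|/ltnW lekj] := leqP j k; [apply: Or43|apply: Or44];
    apply/cut_relP=> l _; exact: leq_trans.
Qed.

(** The descent from [k+1] to [k] can cross no cut other than [k], so the relation determines
    [B]. *)
Lemma mem_cut (k : 'I_m) :
  (k \in B) = ~~ cut_rel (lift ord0 k) (widen_ord (leqnSn m) k).
Proof.
apply/idP/idP => [kB|].
  by apply/cut_relP=> /(_ k kB); rewrite /= /bump /= leqnn ltnn => /(_ isT).
apply: contraR => kNB; apply/cut_relP=> l lB /=; rewrite leq_eqVlt => /orP[/eqP|//].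
by move/val_inj=> kl; rewrite kl lB in kNB.
Qed.

End CutFrame.

Lemma cut_frame_inj m (B C : {set 'I_m}) :
  pframe_iso (cut_frame B) (cut_frame C) -> B = C.
Proof.
case=> f [f_bij f_le f_P]; have f_id := ord_mono_id f_bij f_le.
by apply/setP=> k; rewrite !mem_cut -[X in ~~ X = _]f_P !f_id.
Qed.

(** Reflexivity and compatibility put the order inside [P]. A descent is a chain of unit steps:
    transitivity composes them if all are in [P], and compatibility extracts each step from the
    whole descent. *)
Lemma linear_forest_cut m (W : pframe) :
  #|W| = m.+1 -> preorder_forest W -> linearly_ordered W ->
  exists B : {set 'I_m}, pframe_iso W (cut_frame B).
Proof.
move=> cardW [P_refl P_trans _] le_total.
have [f f_bij f_mono] := chain_iso_ord cardW (@pf_le_refl W) (@pf_le_anti W)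
  (@pf_le_trans W) le_total.
have [g fK gK] := f_bij.
have g_le i j : pf_le (g i) (g j) = (i <= j) by rewrite -f_mono !gK.
pose step (k : 'I_m) := pf_P (g (lift ord0 k)) (g (widen_ord (leqnSn m) k)).
exists [set k | ~~ step k], f; split=> // x y.
rewrite -{2}[x]fK -{2}[y]fK; move: (f x) (f y) => {x y} i j.
apply/cut_relP/idP => [Pij|Pij k]; last first.
  rewrite inE => stepN lejk; rewrite leqNgt; apply: contra stepN => ltki.
  by apply: pf_compat Pij _; rewrite g_le.
(* Induction on a bound [n] for the length of the descent, peeling off the step from [i] to
   [i-1]. *)
have [n le_ijn] : exists n, i <= j + n by exists i; exact: leq_addl.
elim: n => [|n IHn] in i Pij le_ijn *.
  by apply: (pf_compat _ (P_refl (g j))); rewrite ?g_le // -(addn0 j).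
have [leij|ltji] := leqP i j.
  by apply: (pf_compat _ (P_refl (g j))); rewrite ?g_le.
have lt_i1m : i.-1 < m by have := ltn_ord i; lia.
pose k := Ordinal lt_i1m.
have stepk : step k.
  apply/negPn/negP=> stepN; suff: i <= k by rewrite /=; lia.
  by apply: Pij; rewrite ?inE //=; lia.
have -> : i = lift ord0 k by apply: val_inj; rewrite /= /bump /=; lia.
apply: P_trans stepk _; apply: IHn => [l lB lejl|] /=; last by lia.
by have := Pij l lB lejl; lia.
Qed.

(** * Unary-determined linear semirings *)

Section OrdMinMax.
Variable n : nat.
Implicit Types x y : 'I_n.

Definition omax x y := if x <= y then y else x.
Definition omin x y := if x <= y then x else y.

Lemma val_omax x y : omax x y = maxn x y :> nat.
Proof. by rewrite /omax; case: leqP. Qed.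

Lemma val_omin x y : omin x y = minn x y :> nat.
Proof. by rewrite /omin; case: leqP. Qed.

End OrdMinMax.

(** * The semiring of a closure operator *)

Definition closure_operator n (f : 'I_n -> 'I_n) :=
  [/\ forall x : 'I_n, x <= f x, {homo f : x y / x <= y} & forall x, f (f x) = f x].

Section ClosureMul.
Variables (n : nat) (f : 'I_n -> 'I_n).
Hypothesis f_cl : closure_operator f.
Implicit Types x y z : 'I_n.

(** For a closure operator on a chain this is [(f x /\ y) \/ (x /\ f y)], in a form that makes
    associativity tractable. *)
Definition cmul x y := omin (omax x y) (omin (f x) (f y)).

Lemma val_cmul x y : cmul x y = minn (maxn x y) (minn (f x) (f y)) :> nat.
Proof. by rewrite !val_omin val_omax. Qed.

Lemma cmulC : commutative cmul.
Proof. by move=> x y; apply: val_inj; rewrite /= !val_cmul; lia. Qed.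

(** For [x <= y] the product lies between [x] and [f x], and [f] collapses that interval to
    [f x]. *)
Lemma val_closure_cmul x y : f (cmul x y) = minn (f x) (f y) :> nat.
Proof.
have [f_ge f_homo ff] := f_cl.
wlog lexy : x y / x <= y => [IH|].
  by have [/IH//|/ltnW/IH] := leqP x y; rewrite cmulC minnC.
have le_f := f_homo _ _ lexy; have := f_ge x; rewrite (minn_idPl le_f) => le_xfx.
have/f_homo le1 : x <= cmul x y by rewrite val_cmul; lia.
have/f_homo : cmul x y <= f x by rewrite val_cmul; lia.
by rewrite ff; lia.
Qed.

(** Both sides reduce to [(x \/ y \/ z) /\ f x /\ f y /\ f z]. *)
Lemma cmulA : associative cmul.
Proof.
move=> x y z; apply: val_inj.
by rewrite /= val_cmul [RHS]val_cmul !val_closure_cmul !val_cmul; lia.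
Qed.

Lemma cmul_homo x : {homo cmul x : y z / y <= z}.
Proof.
have [_ f_homo _] := f_cl => y z leyz; have := f_homo _ _ leyz.
by rewrite !val_cmul; lia.
Qed.

(** On a chain, a monotone map preserves binary maxima. *)
Lemma cmulDr : right_distributive cmul (@omax n).
Proof.
move=> x y z; apply: val_inj; rewrite /= val_omax.
have [leyz|/ltnW lezy] := leqP y z.
  rewrite {1}/omax leyz; have := cmul_homo x leyz; lia.
have -> : omax y z = y by apply: val_inj; rewrite /= val_omax; lia.
by have := cmul_homo x lezy; lia.
Qed.

Lemma cmulDl : left_distributive cmul (@omax n).
Proof. by move=> x y z; rewrite !(cmulC _ z) cmulDr. Qed.

Lemma omaxA : associative (@omax n).
Proof. by move=> x y z; apply: val_inj; rewrite /= !val_omax; lia. Qed.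

Lemma omaxC : commutative (@omax n).
Proof. by move=> x y; apply: val_inj; rewrite /= !val_omax; lia. Qed.

Definition closure_semiring : semiring :=
  Semiring omaxA omaxC cmulA cmulDr cmulDl.

Lemma closure_sr_le x y : @sr_le closure_semiring x y = (x <= y).
Proof. by rewrite /sr_le -val_eqE /= val_omax; apply/eqP/idP; lia. Qed.

End ClosureMul.

Lemma cmul_top n (f : 'I_n.+1 -> 'I_n.+1) x :
  closure_operator f -> cmul f x ord_max = f x.
Proof.
move=> [f_ge _ _]; apply: val_inj; rewrite /= val_cmul /=.
have := f_ge ord_max; have := ltn_ord (f ord_max); have := ltn_ord x.
by have := ltn_ord (f x); rewrite /=; lia.
Qed.

Lemma closure_semiring_ud n (f : 'I_n.+1 -> 'I_n.+1) (f_cl : closure_operator f) :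
  udcdi_linear_semiring (closure_semiring f_cl).
Proof.
have [f_ge f_homo ff] := f_cl.
split.
- exists (ord_max : closure_semiring f_cl) => [x|x y].
    by rewrite closure_sr_le -ltnS.
  rewrite /sr_meet /= [cmul f ord_max y]cmulC !cmul_top // !closure_sr_le.
  apply: val_inj; rewrite /= val_cmul !val_omax -!/(omin _ _) !val_omin.
  have := f_ge x; have := f_ge y; have := f_homo x y; have := f_homo y x; lia.
- exact: cmulC.
- split=> x; apply: val_inj; rewrite /= ?val_omax ?val_cmul; first lia.
  by have := f_ge x; lia.
- split=> [x|x y|y x z|x y]; rewrite !closure_sr_le //.
  + by rewrite -eqn_leq => /eqP/val_inj.
  + exact: leq_trans.
  + exact: leq_total.
Qed.

Lemma closure_semiring_zero n (f : 'I_n.+1 -> 'I_n.+1)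
    (f_cl : closure_operator f) :
  f ord0 = ord0 -> has_zero (closure_semiring f_cl).
Proof.
move=> f0; exists (ord0 : closure_semiring f_cl).
by split=> x; apply: val_inj; rewrite /= ?val_omax ?val_cmul ?f0 /=; lia.
Qed.

(** * Closure operators and their fixed points *)

Section FixedPoints.
Variables (m : nat) (B : {set 'I_m}).
Implicit Types x y : 'I_m.+2.

(* [k \in B] makes the interior element [k+1] a fixed point. *)
Definition fixed_point x :=
  [|| x == ord0, x == ord_max | [exists k in B, x == k.+1 :> nat]].

(** The closure operator with the prescribed fixed points. The default [ord_max] is a valid
    candidate: it is fixed and above every [x]. *)
Definition next_fixed x : 'I_m.+2 :=
  [arg min_(y < ord_max | (x <= y) && fixed_point y) (y : nat)].

Lemma next_fixedP x :
  [/\ x <= next_fixed x, fixed_point (next_fixed x)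
    & forall y, x <= y -> fixed_point y -> next_fixed x <= y].
Proof.
rewrite /next_fixed; case: arg_minnP => [|y /andP[lexy fy] ymin].
  by rewrite /fixed_point eqxx orbT andbT -ltnS.
by split=> // z lexz fz; apply: ymin; rewrite lexz.
Qed.

Lemma next_fixed_id x : (next_fixed x == x) = fixed_point x.
Proof.
have [lex fx min_x] := next_fixedP x.
apply/eqP/idP => [<- //|fpx]; apply: val_inj => /=.
by have := min_x x (leqnn x) fpx; lia.
Qed.

Lemma next_fixed_closure : closure_operator next_fixed.
Proof.
split=> [x|x y lexy|x]; first by have [] := next_fixedP x.
  have [_ _ min_x] := next_fixedP x; have [ley fy _] := next_fixedP y.
  exact: min_x (leq_trans lexy ley) fy.
by apply/eqP; rewrite next_fixed_id; have [] := next_fixedP x.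
Qed.

Lemma fixed_point0 : fixed_point ord0. Proof. by []. Qed.

Lemma fixed_point_lt (k : 'I_m) x : x = k.+1 :> nat -> fixed_point x = (k \in B).
Proof.
move=> xk; have ltkm := ltn_ord k.
have [x0 xmax] : x != ord0 /\ x != ord_max.
  by split; apply/eqP=> /(congr1 val) /=; lia.
rewrite /fixed_point (negPf x0) (negPf xmax) /=.
apply/exists_inP/idP => [[l lB]|kB]; last by exists k => //; apply/eqP.
by rewrite xk eqSS => /eqP/val_inj->.
Qed.

Definition cut_semiring := closure_semiring next_fixed_closure.

End FixedPoints.

Definition inner m (k : 'I_m) : 'I_m.+2 := lift ord0 (widen_ord (leqnSn m) k).

Lemma val_inner m (k : 'I_m) : inner k = k.+1 :> nat.
Proof. by []. Qed.

Lemma inner_neq_max m (k : 'I_m) : (inner k == ord_max) = false.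
Proof.
apply/negP=> /eqP/(congr1 val) /=; have := ltn_ord k; rewrite /bump /=; lia.
Qed.

Lemma ord_boundary_or_inner m (x : 'I_m.+2) :
  [\/ x = ord0, x = ord_max | exists k : 'I_m, x = inner k].
Proof.
have [x0|x_gt0] := posnP x; first by apply: Or31; apply: val_inj.
have [ltxm|lemx] := ltnP x m.+1; last first.
  by apply: Or32; apply: val_inj => /=; have := ltn_ord x; lia.
have ltm : x.-1 < m by lia.
by apply: Or33; exists (Ordinal ltm); apply: val_inj; rewrite /= /bump /=; lia.
Qed.

(** [f x] is the least fixed point above [x]: it is fixed by idempotence, and a fixed [y >= x]
    satisfies [f x <= f y = y]. *)
Lemma closure_next_fixed m (f : 'I_m.+2 -> 'I_m.+2) :
  closure_operator f -> f ord0 = ord0 ->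
  f =1 next_fixed [set k | f (inner k) == inner k].
Proof.
move=> [f_ge f_homo ff] f0; set B := [set k | _].
have fixedE x : fixed_point B x = (f x == x).
  case: (ord_boundary_or_inner x) => [->|->|[k ->]].
  - by rewrite f0 eqxx.
  - rewrite /fixed_point eqxx orbT; apply/esym/eqP/val_inj => /=.
    by have := f_ge ord_max; have := ltn_ord (f ord_max); rewrite /=; lia.
  - by rewrite (fixed_point_lt _ (val_inner k)) inE.
move=> x; have [le_x fix_x min_x] := next_fixedP B x.
apply: val_inj => /=; apply/eqP; rewrite eqn_leq min_x ?fixedE ?ff //.
rewrite fixedE in fix_x; by rewrite -(eqP fix_x) f_homo.
Qed.

(** Preserving joins means preserving the order, so the isomorphism is the identity. Multiplying by
    the top then recovers the closure operator, and its fixed points recover the code. *)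
Lemma cut_semiring_iso_eq m (B C : {set 'I_m}) :
  semiring_iso (cut_semiring B) (cut_semiring C) -> B = C.
Proof.
case=> h [h_bij h_join h_mul].
have h_id : h =1 id.
  apply: ord_mono_id => // x y.
  rewrite -(closure_sr_le (next_fixed_closure B)).
  rewrite -(closure_sr_le (next_fixed_closure C)) /sr_le -h_join.
  by rewrite (inj_eq (bij_inj h_bij)).
have nextE x : next_fixed B x = next_fixed C x.
  have := h_mul x ord_max; rewrite !h_id /=.
  by rewrite !cmul_top //; apply: next_fixed_closure.
apply/setP=> k; rewrite -!(fixed_point_lt _ (val_inner k)) -!next_fixed_id.
by rewrite nextE.
Qed.

Lemma ud_semiring_cut m (S : semiring) :
  #|S| = m.+2 -> has_zero S -> udcdi_linear_semiring S ->
  exists B : {set 'I_m}, semiring_iso S (cut_semiring B).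
Proof.
move=> cardS [z [z_id z_mul _]] [[t t_top ud] mulC [joinI mulI]].
case=> le_refl le_anti le_trans le_total.
have [h h_bij h_mono] := chain_iso_ord cardS le_refl le_anti le_trans le_total.
have [g hK gK] := h_bij.
have h_join x y : h (sr_join x y) = omax (h x) (h y).
  rewrite /omax h_mono; case: ifP => [/eqP->//|nlexy].
  by have := le_total x y; rewrite nlexy sr_joinC => /eqP->.
have h_meet x y : h (sr_meet x y) = omin (h x) (h y).
  by rewrite /omin h_mono /sr_meet; case: ifP.
have mul_homo x y w : sr_le x y -> sr_le (sr_mul x w) (sr_mul y w).
  by move=> /eqP lexy; rewrite /sr_le -sr_mulDl lexy.
pose f i := h (sr_mul (g i) t).
have f_cl : closure_operator f.
  split=> [i|i j leij|i]; rewrite /f.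
  (* Extensivity: [x = x * x <= t * x]. *)
  - rewrite -{1}[i]gK -{1}[g i]mulI h_mono (mulC _ t).
    exact: mul_homo.
  - by rewrite h_mono; apply: mul_homo; rewrite -h_mono !gK.
  - by rewrite hK -sr_mulA mulI.
(* The zero is neutral for join, hence least, and it annihilates [t]; so the bottom is closed. *)
have hz : h z = ord0.
  have : h z <= h (g ord0) by rewrite h_mono; apply/eqP/z_id.
  by rewrite gK leqn0 => /eqP hz0; apply: val_inj.
have f0 : f ord0 = ord0 by rewrite /f -hz hK z_mul.
have fE := closure_next_fixed f_cl f0.
exists [set k | f (inner k) == inner k], h; split=> // x y.
rewrite ud h_join !h_meet (mulC t).
have fh w : h (sr_mul w t) = f (h w) by rewrite /f hK.
apply: val_inj; rewrite /= val_cmul -!fE val_omax !val_omin !fh.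
have [f_ge f_homo _] := f_cl; have := f_ge (h x); have := f_ge (h y).
by have := f_homo (h x) (h y); have := f_homo (h y) (h x); lia.
Qed.

(** * Semirings with an identity *)

Lemma iso_has_identity (S T : semiring) :
  semiring_iso S T -> has_identity S -> has_identity T.
Proof.
case=> h [[g hK gK] _ h_mul] [e [e_l e_r]].
by exists (h e); split=> x; rewrite -[x]gK -h_mul ?e_l ?e_r.
Qed.

Definition initial_cuts m (e : 'I_m.+1) : {set 'I_m} := [set k : 'I_m | k < e].

Lemma card_initial_cuts m (e : 'I_m.+1) : #|initial_cuts e| = e.
Proof.
have lem : e <= m by rewrite -ltnS.
have widen_inj : injective (widen_ord lem).
  by move=> i j [] /val_inj.
rewrite -[RHS]card_ord -(card_imset _ widen_inj).
apply: eq_card => k; rewrite inE; apply/idP/imsetP => [ltke|[i _ ->] //=].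
by exists (Ordinal ltke) => //; apply: val_inj.
Qed.

Lemma initial_cuts_identity m (e : 'I_m.+1) :
  has_identity (cut_semiring (initial_cuts e)).
Proof.
have fixedE x : fixed_point (initial_cuts e) x = (x <= e) || (x == ord_max).
  case: (ord_boundary_or_inner x) => [->|->|[k ->]].
  - by [].
  - by rewrite /fixed_point eqxx !orbT.
  - by rewrite (fixed_point_lt _ (val_inner k)) inE inner_neq_max orbF val_inner.
set f := next_fixed (initial_cuts e).
have f_top (x : 'I_m.+2) : e < x -> f x = ord_max.
  move=> ltex; have [] := next_fixedP (initial_cuts e) x.
  rewrite -/f fixedE => le_x.
  by case/orP=> [lefe|/eqP//] _; have := leq_trans ltex le_x; lia.
(* The identity is [e+1]: elements up to [e] are closed, so the meet with [f x] returns [x]; all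
   others have closure top, so the product is the join with [e+1]. *)
have mul_e : left_id (lift ord0 e) (cmul f).
  move=> x; apply: val_inj; rewrite /= val_cmul f_top //=.
  have [lexe|ltex] := leqP x e; last first.
    by rewrite f_top //= /bump /=; have := ltn_ord x; lia.
  have/eqP-> : f x == x by rewrite next_fixed_id fixedE lexe.
  by rewrite /bump /=; have := ltn_ord x; lia.
by exists (lift ord0 e); split=> x; rewrite /= ?(cmulC _ x) mul_e.
Qed.

(** Multiplying [e] by the top gives [f e = ord_max], so everything from [e] on closes to the top.
    For [x < e], the equation [e * x = x] reads [e /\ f x = x] and forces [f x = x]. *)
Lemma identity_initial_cuts m (B : {set 'I_m}) :
  has_identity (cut_semiring B) -> exists e, B = initial_cuts e.
Proof.
case=> /= e [e_l _]; set f := next_fixed B in e_l.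
have f_cl : closure_operator f by apply: next_fixed_closure.
have fe : f e = ord_max by rewrite -(cmul_top _ f_cl) e_l.
have fixedE x : fixed_point B x = (x < e) || (x == ord_max).
  rewrite -next_fixed_id -/f; have [ltxe|leex] := ltnP x e.
    have := congr1 val (e_l x); rewrite /= val_cmul fe -val_eqE /=.
    by have [f_ge _ _] := f_cl; have := f_ge x; have := ltn_ord (f x); lia.
  have [_ /(_ _ _ leex) + _] := f_cl; rewrite fe /= => lefx.
  have -> : f x = ord_max by apply: val_inj; have := ltn_ord (f x); rewrite /=; lia.
  by rewrite eq_sym.
(* The bottom is fixed and differs from the top, so it lies strictly below [e]. *)
have e_gt0 : 0 < e by have := fixedE ord0; rewrite fixed_point0 -val_eqE /=; lia.
have lte : e.-1 < m.+1 by have := ltn_ord e; lia.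
(* Code [k] stands for the element [k+1], so [k+1 < e] becomes [k < e-1]. *)
exists (Ordinal lte); apply/setP=> k.
rewrite -(fixed_point_lt _ (val_inner k)) fixedE inE inner_neq_max orbF val_inner /=; lia.
Qed.

Theorem theorem6p2 :
  (forall n : nat, 1 <= n ->
     count_up_to_iso pframe_iso
       (fun W : pframe =>
          [/\ #|W| = n, preorder_forest W & linearly_ordered W])
       (2 ^ (n - 1)))
  /\
  (forall n : nat, 1 < n ->
     count_up_to_iso semiring_iso
       (fun S : semiring =>
          [/\ #|S| = n, has_zero S & udcdi_linear_semiring S])
       (2 ^ (n - 2))
     /\
     count_up_to_iso semiring_iso
       (fun S : semiring =>
          [/\ #|S| = n, has_zero S, udcdi_linear_semiring S & has_identity S])
       (n - 1)).
Proof.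
split=> [[//|m] _|[//|[//|m]] _].
  rewrite subn1 /= -card_set_ord.
  apply: (count_up_to_iso_card (F := @cut_frame m)) => [B|B C|W].
  - split; [by rewrite card_ord|exact: cut_frame_forest|].
    by move=> i j; apply: leq_total.
  - exact: cut_frame_inj.
  - by case; apply: linear_forest_cut.
have cut_class (B : {set 'I_m}) :
  [/\ #|cut_semiring B| = m.+2, has_zero (cut_semiring B)
    & udcdi_linear_semiring (cut_semiring B)].
  split; [by rewrite card_ord| |exact: closure_semiring_ud].
  by apply: closure_semiring_zero; apply/eqP; rewrite next_fixed_id.
split.
  rewrite subn2 /= -card_set_ord.
  apply: (count_up_to_iso_card (F := @cut_semiring m)) => // [B C|S].
    exact: cut_semiring_iso_eq.
  by case; apply: ud_semiring_cut.
rewrite subn1 /=; exists (fun e => cut_semiring (initial_cuts e)).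
split=> [e|d e|S [cardS zS udS idS]].
- by have [] := cut_class (initial_cuts e); split=> //; apply: initial_cuts_identity.
(* Initial segments are told apart by their cardinality. *)
- move=> /cut_semiring_iso_eq/(congr1 (fun B : {set 'I_m} => #|B|)).
  by rewrite !card_initial_cuts => /val_inj.
- have [B isoSB] := ud_semiring_cut cardS zS udS.
  have [e eB] := identity_initial_cuts (iso_has_identity isoSB idS).
  by exists e; rewrite -eB.
Qed.
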